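(* For every signed graph $(G,\sigma)$ and every positive integer $k$, $\chi\big(\hat{G}^{[-k]}\big)\le \mathrm{wcol}_{2k}(G)$. Moreover, if $k$ is odd, then $\chi\big(\hat{G}^{[-k]}\big)\le \mathrm{wcol}_{2k-1}(G)$.
   Context: A signed graph $(G,\sigma)$ is a finite simple graph $G$ with $\sigma:E(G)\to\{+,-\}$; the sign of a path is the product of its edge signs. For a positive integer $k$, $\hat{G}^{[-k]}$ is the graph on $V(G)$ in which $xy$ is an edge iff $d_G(x,y)=k$ and every $xy$-path of length $k$ is negative. For a total ordering $L$ of $V(G)$ and $y\in V(G)$, a vertex $x$ is weakly $r$-reachable from $y$ if there is an $xy$-path $P$ of length at most $r$ with $x\le_L z$ for all vertices $z$ of $P$; $\mathrm{WReach}_r[G,L,y]$ is the set of such $x$ (including $y$ itself). $\mathrm{wcol}_r(G)=\min_L\max_{v\in V(G)}|\mathrm{WReach}_r[G,L,v]|$. *)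

(* Defs.v *)
From mathcomp Require Import all_boot.
Set Implicit Arguments.
Unset Strict Implicit.
Unset Printing Implicit Defensive.

Record sgraph := SGraph {
  vertex :> finType;
  adj : rel vertex;
  adj_sym : symmetric adj;
  adj_irrefl : irreflexive adj }.

(* A signature assigns to the edge xy the sign of [set x; y], with true for -
   and false for +, so that the product of signs is addb. Its values on sets
   that are not edges are never used. *)
Definition signature (G : sgraph) := {set G} -> bool.

Section Paths.
Variable G : sgraph.
Implicit Types (x y : G) (p : seq G).

(* x :: p is the vertex sequence of a path from x to y; its length is size p. *)
Definition xypath x y p :=
  [&& path (@adj G) x p, uniq (x :: p) & last x p == y].

Definition has_xypath n x y := [exists p : n.-tuple G, xypath x y p].

(* None stands for an infinite distance; a path has fewer than #|G| edges. *)
Definition dist x y : option nat :=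
  ohead [seq n <- iota 0 #|G| | has_xypath n x y].

Definition path_neg (sigma : signature G) x p : bool :=
  \big[addb/false]_(e <- pairmap (fun u v => [set u; v]) x p) sigma e.

Lemma last_rev_belast x p : last (last x p) (rev (belast x p)) = x.
Proof. by case: p => //= a p; rewrite rev_cons last_rcons. Qed.

Lemma xypath_rev x y p : xypath x y p -> xypath y x (rev (belast x p)).
Proof.
case/and3P=> pp up /eqP <-; apply/and3P; split.
- by rewrite rev_path (eq_path (e' := @adj G)) // => u v; rewrite adj_sym.
- by rewrite -rev_rcons -lastI rev_uniq.
- by rewrite last_rev_belast.
Qed.

Lemma has_xypath_sym n : symmetric (has_xypath n).
Proof.
suff imp x y : has_xypath n x y -> has_xypath n y x.
  by move=> x y; apply/idP/idP; apply: imp.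
case/existsP=> p pP; apply/existsP.
have sz : size (rev (belast x p)) == n.
  by rewrite size_rev size_belast size_tuple.
by exists (Tuple sz); apply: xypath_rev.
Qed.

Lemma dist_sym x y : dist x y = dist y x.
Proof.
by rewrite /dist; congr ohead; apply: eq_filter => n; rewrite has_xypath_sym.
Qed.

Lemma has_xypath0 x : has_xypath 0 x x.
Proof. by apply/existsP; exists [tuple]; rewrite /xypath /= eqxx. Qed.

Lemma dist_refl x : dist x x = Some 0.
Proof.
rewrite /dist; have: 0 < #|G| by apply/card_gt0P; exists x.
by case: #|G| => //= n _; rewrite has_xypath0.
Qed.

Lemma path_neg_rev sigma x p :
  path_neg sigma (last x p) (rev (belast x p)) = path_neg sigma x p.
Proof.
rewrite /path_neg; elim: p x => [|a p IHp] x //=.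
rewrite rev_cons -cats1 pairmap_cat big_cat /= IHp last_rev_belast.
by rewrite !big_cons big_nil addbF addbC setUC.
Qed.

End Paths.

Section SignedPower.
Variables (G : sgraph) (sigma : signature G) (k : nat).

Definition neg_power_adj : rel G := fun x y =>
  (dist x y == Some k) &&
  [forall p : k.-tuple G, xypath x y p ==> path_neg sigma x p].

Lemma neg_power_adj_sym : symmetric neg_power_adj.
Proof.
suff imp x y : neg_power_adj x y -> neg_power_adj y x.
  by move=> x y; apply/idP/idP; apply: imp.
case/andP=> dxy /forallP neg; apply/andP; split; first by rewrite dist_sym.
apply/forallP=> p; apply/implyP=> pP.
have sz : size (rev (belast y p)) == k.
  by rewrite size_rev size_belast size_tuple.
have /implyP := neg (Tuple sz); move/(_ (xypath_rev pP)) => /=.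
by case/and3P: pP => _ _ /eqP <-; rewrite path_neg_rev.
Qed.

Lemma neg_power_adj_irrefl : irreflexive neg_power_adj.
Proof.
move=> x; apply/negP; rewrite /neg_power_adj dist_refl.
case/andP=> /eqP[k0] /forallP neg; have szk : size (@nil G) == k by rewrite -k0.
have /implyP := neg (Tuple szk).
by rewrite /xypath /path_neg /= big_nil eqxx => /(_ isT).
Qed.

Definition neg_power : sgraph :=
  SGraph neg_power_adj_sym neg_power_adj_irrefl.

End SignedPower.

Section ChromaticNumber.
Variable G : sgraph.

Definition colorable (c : nat) : bool :=
  [exists f : {ffun G -> 'I_c}, forall x, forall y, adj x y ==> (f x != f y)].

Lemma colorable_ex : exists c, colorable c.
Proof.
exists #|G|; apply/existsP; exists [ffun x => enum_rank x].
apply/forallP=> x; apply/forallP=> y; apply/implyP=> xy; rewrite !ffunE.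
by apply: contraTneq xy => /enum_rank_inj->; rewrite adj_irrefl.
Qed.

Definition chi : nat := ex_minn colorable_ex.

End ChromaticNumber.

Section WeakColoring.
Variable G : sgraph.

(* A binary relation is a set of pairs, so that orderings form a finite type. *)
Definition total_ordering (L : {set G * G}) : bool :=
  [&& [forall x, forall y, ((x, y) \in L) || ((y, x) \in L)],
      [forall x, forall y, ((x, y) \in L) && ((y, x) \in L) ==> (x == y)] &
      [forall x, forall y, forall z,
         ((x, y) \in L) && ((y, z) \in L) ==> ((x, z) \in L)]].

Definition WReach (r : nat) (L : {set G * G}) (y : G) : {set G} :=
  [set x | [exists n : 'I_r.+1, exists p : n.-tuple G,
              xypath x y p && all (fun z => (x, z) \in L) (x :: p)]].

Definition wcol_attained (r m : nat) : bool :=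
  [exists L : {set G * G},
     total_ordering L && (\max_(v : G) #|WReach r L v| == m)].

Lemma wcol_attained_ex r : exists m, wcol_attained r m.
Proof.
pose L := [set p : G * G | enum_rank p.1 <= enum_rank p.2].
exists (\max_(v : G) #|WReach r L v|); apply/existsP; exists L.
rewrite eqxx andbT; apply/and3P; split.
- by apply/forallP=> x; apply/forallP=> y; rewrite !inE leq_total.
- apply/forallP=> x; apply/forallP=> y; rewrite !inE /= -eqn_leq.
  by apply/implyP=> /eqP/val_inj/enum_rank_inj->.
- apply/forallP=> x; apply/forallP=> y; apply/forallP=> z; rewrite !inE /=.
  by apply/implyP=> /andP[]; apply: leq_trans.
Qed.

Definition wcol (r : nat) : nat := ex_minn (wcol_attained_ex r).

End WeakColoring.

(* Main.v *)
(* Fix an ordering L and let B(x) be the set of ends of walks from x that have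
   length less than k/2, or have length exactly k/2 and are positive. Map x to
   the L-least vertex h(x) of B(x). Let xy be an edge of the negative power. If
   h(x) = h(y), joining the two walks gives an xy-walk of length at most k = d(x,y),
   hence a path of length k; both halves are then positive, a contradiction.
   On the other hand every vertex of a shortest xy-path lies in B(x) or B(y): the
   middle one (k even) because the path is negative, so one of its halves is
   positive. Thus the walk h(x) .. x .. y .. h(y) stays in the union of B(x) and
   B(y), so the lesser of h(x), h(y) is weakly reachable from the other. Colouring
   greedily along L and composing with h gives the bound. *)
Require Import Defs.
From mathcomp Require Import all_boot zify.

Set Implicit Arguments.
Unset Strict Implicit.
Unset Printing Implicit Defensive.

(** The first hit in an increasing enumeration is the least; any [i] beyond the enumerated range
    exceeds [k] anyway. *)
Lemma ohead_filter_iota (a : pred nat) m n k :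
  ohead [seq i <- iota m n | a i] = Some k ->
  a k /\ forall i, m <= i -> a i -> k <= i.
Proof.
elim: n m => [|n IHn] m //=; case: ifP => [am [<-] //|nam /IHn[ak kmin]].
split=> // i; rewrite leq_eqVlt => /predU1P[<-|]; first by rewrite nam.
exact: kmin.
Qed.

(** * Walks, paths and distance *)

Section Walks.
Variable G : sgraph.
Implicit Types (x y z : G) (p q : seq G).

Definition walk x y p := path (@adj G) x p && (last x p == y).

Lemma walk_cat x y z p q : walk x y p -> walk y z q -> walk x z (p ++ q).
Proof.
case/andP=> pp /eqP <- /andP[pq /eqP <-].
by rewrite /walk cat_path pp pq last_cat eqxx.
Qed.

Lemma walk_rev x y p : walk x y p -> walk y x (rev (belast x p)).
Proof.
case/andP=> pp /eqP <-; apply/andP; split; last by rewrite last_rev_belast.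
by rewrite rev_path (eq_path (e' := @adj G)) // => u v; rewrite adj_sym.
Qed.

Lemma mem_walk_rev x y p : walk x y p -> y :: rev (belast x p) =i x :: p.
Proof. by case/andP=> _ /eqP <- z; rewrite -rev_rcons -lastI mem_rev. Qed.

Lemma xypath_walk x y p : xypath x y p -> walk x y p.
Proof. by case/and3P=> pp _ lp; apply/andP. Qed.

Lemma walk_xypath x y p : walk x y p ->
  exists q, [/\ xypath x y q, size q <= size p & {subset x :: q <= x :: p}].
Proof.
case/andP=> pp /eqP <-; case/shortenP: pp => q pq uq sub.
exists q; split; first by apply/and3P.
  by apply: uniq_leq_size sub; case/andP: uq.
by move=> z; rewrite !inE => /orP[->//|/sub ->]; rewrite orbT.
Qed.

Lemma has_xypathP n x y :
  reflect (exists2 p, xypath x y p & size p = n) (has_xypath n x y).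
Proof.
apply: (iffP existsP) => [[p pP]|[p pP /eqP sz]]; last by exists (Tuple sz).
by exists p; rewrite ?size_tuple.
Qed.

Lemma dist_xypath x y k :
  dist x y = Some k -> exists2 p, xypath x y p & size p = k.
Proof. by case/ohead_filter_iota => /has_xypathP. Qed.

Lemma dist_le_walk x y k p : dist x y = Some k -> walk x y p -> k <= size p.
Proof.
case/ohead_filter_iota=> _ kmin /walk_xypath[q [qP sq _]].
by apply: leq_trans sq; apply: kmin => //; apply/has_xypathP; exists q.
Qed.

(** The path extracted from [p] uses only vertices of [p] and, by the distance, is at least as long,
    so [p] has no room for a repeated vertex. *)
Lemma dist_walk_xypath x y p :
  dist x y = Some (size p) -> walk x y p -> xypath x y p.
Proof.
move=> dxy wp; have [q [qP _ sub]] := walk_xypath wp.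
have := dist_le_walk dxy (xypath_walk qP).
case/and3P: qP => _ uq _; case/andP: wp => pp lp szpq.
by apply/and3P; split=> //; apply: leq_size_uniq uq sub _.
Qed.

Lemma path_neg_cat (sigma : signature G) x p q :
  path_neg sigma x (p ++ q) =
  path_neg sigma x p (+) path_neg sigma (last x p) q.
Proof. by rewrite /path_neg pairmap_cat big_cat. Qed.

End Walks.

(** * Signed balls of radius k/2 *)

Section HalfBall.
Variables (G : sgraph) (sigma : signature G) (k : nat).
Hypothesis k_gt0 : 0 < k.
Implicit Types (x y z : G) (p q : seq G).

(** Doubling the length avoids the fraction k/2; the second alternative can occur only for even
    [k]. *)
Definition half_short x p :=
  (2 * size p < k) || (2 * size p == k) && ~~ path_neg sigma x p.

(** This is B(x). The bound [k] on the length only makes the quantifier finite, since [half_short]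
    is stricter. *)
Definition half_ball x : {set G} :=
  [set z | [exists n : 'I_k.+1, exists p : n.-tuple G,
              walk x z p && half_short x p]].

Lemma half_short_size x p : half_short x p -> 2 * size p <= k.
Proof. by case/orP=> [/ltnW|/andP[/eqP-> _]]. Qed.

Lemma half_ballP x z :
  reflect (exists2 p, walk x z p & half_short x p) (z \in half_ball x).
Proof.
rewrite inE; apply: (iffP existsP) => [[n /existsP[p /andP[]]]|[p wp sp]].
  by exists p.
have ltp : size p < k.+1 by have := half_short_size sp; lia.
by exists (Ordinal ltp); apply/existsP; exists (in_tuple p); apply/andP.
Qed.

Lemma half_ball_refl x : x \in half_ball x.
Proof.
by apply/half_ballP; exists [::]; rewrite /walk /half_short /= ?eqxx ?k_gt0.
Qed.

Lemma half_ball_prefix x z p :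
  walk x z p -> half_short x p -> {subset x :: p <= half_ball x}.
Proof.
move=> wp sp u; rewrite inE => /predU1P[->|up]; first exact: half_ball_refl.
case/splitPr: up wp sp => p1 p2 /andP[pp _] sp.
apply/half_ballP; exists (rcons p1 u).
  rewrite /walk last_rcons eqxx andbT.
  by move: pp; rewrite -cat_rcons cat_path => /andP[].
(* A proper prefix is strictly shorter than k/2, so its sign does not matter. *)
case: p2 sp {pp} => [|v p2]; first by rewrite cats1.
by move/half_short_size; rewrite /half_short size_cat size_rcons /=; lia.
Qed.

Lemma neg_power_half_balls_disjoint x y z :
  neg_power_adj sigma k x y -> z \in half_ball x -> z \notin half_ball y.
Proof.
case/andP=> /eqP dxy /forallP neg /half_ballP[p wp sp].
apply/negP=> /half_ballP[q wq sq].
have wpq := walk_cat wp (walk_rev wq).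
have sz : size (p ++ rev (belast y q)) = size p + size q.
  by rewrite size_cat size_rev size_belast.
have := dist_le_walk dxy wpq; rewrite sz => kpq.
have lep := half_short_size sp; have leq := half_short_size sq.
(* The total is at least the distance [k] and at most twice k/2, hence exactly [k]; the joined walk
   is therefore a path. *)
have szk : size (p ++ rev (belast y q)) == k by rewrite sz; lia.
have /= /implyP := neg (Tuple szk).
move/(_ (dist_walk_xypath _ wpq)); rewrite (eqP szk) => /(_ dxy).
have lpq : last x p = last y q.
  by case/andP: wp => _ /eqP->; case/andP: wq => _ /eqP->.
rewrite path_neg_cat lpq path_neg_rev.
move: sp sq; rewrite /half_short !ltnNge.
have -> : k <= 2 * size p by lia.
have -> : k <= 2 * size q by lia.
by move=> /andP[_ /negPf->] /andP[_ /negPf->].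
Qed.

Lemma neg_power_geodesic_cover x y p :
  neg_power_adj sigma k x y -> xypath x y p -> size p = k ->
  {subset x :: p <= half_ball x :|: half_ball y}.
Proof.
case/andP=> _ /forallP neg pP /eqP szp u up.
have /= /implyP/(_ pP) := neg (Tuple szp).
have /andP[pp /eqP lp] := xypath_walk pP.
case/splitPl: up szp pp lp {pP neg} => p1 p2 lp1.
rewrite size_cat cat_path last_cat path_neg_cat lp1.
move=> /eqP szp /andP[pp1 pp2] lp2 neg12.
have w1 : walk x u p1 by rewrite /walk pp1 lp1 eqxx.
have w2 : walk u y p2 by rewrite /walk pp2 lp2 eqxx.
apply/setUP.
have [s1|ns1] := boolP (half_short x p1); [left | right]; apply/half_ballP.
  by exists p1.
exists (rev (belast u p2)); first exact: walk_rev.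
rewrite /half_short size_rev size_belast -lp2 path_neg_rev.
move: ns1 neg12; rewrite /half_short.
(* The lengths add up to [k] and the signs differ, so if the first part is not short, the second is
   shorter than k/2 or is a positive half. *)
by case: (path_neg sigma x p1); case: (path_neg sigma u p2) => //=; lia.
Qed.

Lemma neg_power_half_ball_walk x y a b :
  neg_power_adj sigma k x y -> a \in half_ball x -> b \in half_ball y ->
  exists p, [/\ walk a b p, size p <= 2 * k - odd k &
                {subset a :: p <= half_ball x :|: half_ball y}].
Proof.
move=> xy /half_ballP[p wp sp] /half_ballP[q wq sq].
have /andP[/eqP dxy _] := xy; have [g gP szg] := dist_xypath dxy.
exists (rev (belast x p) ++ g ++ q); split.
- exact: walk_cat (walk_rev wp) (walk_cat (xypath_walk gP) wq).
- rewrite !size_cat size_rev size_belast szg.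
  have := half_short_size sp; have := half_short_size sq.
  (* Each end walk has length at most the integer part of k/2, which saves one step in total when
     [k] is odd. *)
  by have := odd_double_half k; lia.
move=> u; rewrite -cat_cons mem_cat (mem_walk_rev wp) => /orP[up|].
  by rewrite in_setU (half_ball_prefix wp sp up).
rewrite mem_cat => /orP[ug|uq].
  by apply: (neg_power_geodesic_cover xy gP szg); rewrite inE ug orbT.
by rewrite in_setU (half_ball_prefix wq sq) ?orbT // inE uq orbT.
Qed.

End HalfBall.

(** * Greedy colouring along an ordering *)

Lemma degenerate_coloring (T : finType) (R : T -> {set T}) (rank : T -> nat) N :
  (forall u v, u \in R v -> rank u < rank v) ->
  (forall v, #|R v| < N) ->
  exists2 f : T -> nat, (forall v, f v < N) &
    (forall u v, u \in R v -> f u != f v).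
Proof.
move=> rankR cardR.
(* Colour rank by rank: [f] is correct on all ranks below [n]. *)
suff /(_ (\max_v rank v).+1)[f fP] n : exists f : T -> nat,
    forall v, rank v < n -> f v < N /\ forall u, u \in R v -> f u != f v.
  by exists f => [v|u v];
    have [|fv fR] := fP v; rewrite ?ltnS ?leq_bigmax //; apply: fR.
elim: n => [|n [f fP]]; first by exists (fun=> 0).
pose used v := [seq f u | u <- enum (R v)].
(* The least free colour; the default 0 is never taken, because the list is shown to be nonempty. *)
pose new v := head 0 [seq c <- iota 0 N | c \notin used v].
have newP v : new v < N /\ new v \notin used v.
  suff : new v \in [seq c <- iota 0 N | c \notin used v].
    by rewrite mem_filter mem_iota => /and3P[].
  suff: has [pred c | c \notin used v] (iota 0 N).
    by rewrite has_filter /new /=; case: filter => //= c s _; rewrite mem_head.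
  (* If all [N] colours were used, then [R v] would have at least [N] elements. *)
  apply: contraLR (cardR v) => /hasPn all_used.
  rewrite -leqNgt cardE -(size_map f) -[N in N <= _](size_iota 0).
  by apply: uniq_leq_size (iota_uniq _ _) _ => c /all_used /negPn.
exists (fun v => if rank v < n then f v else new v) => v vn.
case: (ltnP (rank v) n) => [ltv|lev].
  have [fv fR] := fP v ltv; split=> // u uv.
  by rewrite (ltn_trans (rankR _ _ uv) ltv) fR.
have [newN newU] := newP v; split=> // u uv.
rewrite (leq_trans (rankR _ _ uv) vn).
by apply: contraNneq newU => <-; rewrite map_f // mem_enum.
Qed.

(** * Total orderings and weak reachability *)

Section OrderRank.
Variables (G : sgraph) (L : {set G * G}).
Hypothesis L_total : total_ordering L.
Implicit Types u v w : G.

Lemma total_orderingP :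
  [/\ forall u v, (u, v) \in L \/ (v, u) \in L,
      forall u v, (u, v) \in L -> (v, u) \in L -> u = v &
      forall v u w, (u, v) \in L -> (v, w) \in L -> (u, w) \in L].
Proof.
case/and3P: L_total => /forallP tot /forallP anti /forallP trans; split.
- by move=> u v; apply/orP; apply: (forallP (tot u)).
- move=> u v uv vu; have /forallP/(_ v) := anti u.
  by rewrite uv vu => /eqP.
- move=> v u w uv vw; have /forallP/(_ v)/forallP/(_ w) := trans u.
  by rewrite uv vw.
Qed.

(** The position of [v] in [L], a numerical form of the ordering that serves both the greedy
    colouring and the choice of least elements. *)
Definition order_rank v := #|[set u | (u, v) \in L]|.

Lemma order_rank_lt u v : (u, v) \in L -> u != v -> order_rank u < order_rank v.
Proof.
have [tot anti trans] := total_orderingP => uv neq.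
apply: proper_card; apply/properP; split.
  by apply/subsetP=> w; rewrite !inE => /trans; apply.
exists v; rewrite inE; first by case: (tot v v).
by apply: contra neq => vu; apply/eqP/anti.
Qed.

Lemma order_rank_le u v : order_rank u <= order_rank v -> (u, v) \in L.
Proof.
have [tot _ _] := total_orderingP; have [//|vu] := tot u v.
have [->|neq] := eqVneq v u; first by case: (tot u u).
by rewrite leqNgt order_rank_lt.
Qed.

Lemma walk_WReach r u v p : walk u v p -> size p <= r ->
  (forall z, z \in u :: p -> (u, z) \in L) -> u \in WReach r L v.
Proof.
case/walk_xypath=> q [qP sq sub] sp lp; rewrite inE.
have ltq : size q < r.+1 by rewrite ltnS (leq_trans sq).
apply/existsP; exists (Ordinal ltq); apply/existsP; exists (in_tuple q).
by rewrite qP; apply/allP=> z /sub /lp.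
Qed.

Lemma WReach_order r u v : u \in WReach r L v -> (u, v) \in L.
Proof.
rewrite inE => /existsP[n /existsP[p /andP[/xypath_walk/andP[_ /eqP <-]]]].
by move/allP; apply; apply: mem_last.
Qed.

Lemma WReach_refl r v : v \in WReach r L v.
Proof.
apply: (@walk_WReach r v v [::]); rewrite /walk ?eqxx // => z.
by rewrite inE => /eqP->; have [tot _ _] := total_orderingP; case: (tot v v).
Qed.

End OrderRank.

(** * Bounds on the chromatic number *)

Lemma chi_le (H : sgraph) (f : H -> nat) N :
  (forall x, f x < N) -> (forall x y, adj x y -> f x != f y) -> chi H <= N.
Proof.
move=> fN fP; rewrite /chi; case: ex_minnP => c _; apply.
apply/existsP; exists [ffun x => Ordinal (fN x)].
apply/forallP=> x; apply/forallP=> y; apply/implyP=> /fP.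
by rewrite !ffunE.
Qed.

(** Each [h] is a homomorphism to the graph on [G] that joins two distinct vertices when one is
    weakly reachable from the other; a greedy colouring of that graph pulls back to [H]. *)
Lemma chi_le_wcol (G H : sgraph) r :
  (forall L : {set G * G}, total_ordering L ->
    exists h : H -> G, forall x y, adj x y ->
      h x != h y /\ (h x \in WReach r L (h y) \/ h y \in WReach r L (h x))) ->
  chi H <= wcol G r.
Proof.
move=> hyp; rewrite /wcol; case: ex_minnP => N /existsP[L /andP[Ltot /eqP maxN]] _.
have [h hP] := hyp L Ltot.
have [|v|f fN fP] := @degenerate_coloring G (fun v => WReach r L v :\ v)
  (order_rank L) N.
- move=> u v /setD1P[neq uv].
  by apply: order_rank_lt neq => //; apply: WReach_order uv.
- rewrite -maxN; apply: leq_trans (leq_bigmax v).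
  (* Since [v] reaches itself, deleting it makes the inequality strict. *)
  by rewrite [leqRHS](cardsD1 v) WReach_refl.
apply: (@chi_le H (f \o h)) => [x|x y /hP[neq]] /=; first exact: fN.
case=> reach; last rewrite eq_sym.
  by apply: fP; rewrite in_setD1 neq.
by apply: fP; rewrite in_setD1 eq_sym neq.
Qed.

(** The length [2 * k - odd k] treats both parities at once. *)
Lemma chi_neg_power_le (G : sgraph) (sigma : signature G) k r :
  0 < k -> 2 * k - odd k <= r -> chi (neg_power sigma k) <= wcol G r.
Proof.
move=> k_gt0 ler; apply: chi_le_wcol => L Ltot.
pose h x := [arg min_(z < x | z \in half_ball sigma k x) order_rank L z].
have hP x : h x \in half_ball sigma k x /\
    forall z, z \in half_ball sigma k x -> (h x, z) \in L.
  rewrite /h; case: arg_minnP => [|m mB mmin]; first exact: half_ball_refl.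
  by split=> // z /mmin; apply: order_rank_le.
have [tot _ trans] := total_orderingP Ltot.
have reach x y : neg_power_adj sigma k x y -> (h x, h y) \in L ->
    h x \in WReach r L (h y).
  move=> xy hxy; have [hx xmin] := hP x; have [hy ymin] := hP y.
  have [p [wp sp sub]] := neg_power_half_ball_walk k_gt0 xy hx hy.
  (* A vertex of B(x) lies above [h x] by minimality, and one of B(y) lies above [h y], hence above
     [h x]. *)
  apply: walk_WReach wp (leq_trans sp ler) _ => z /sub /setUP[/xmin //|/ymin].
  exact: trans.
exists h => x y xy; split.
  have [hx _] := hP x; have [hy _] := hP y.
  apply: contraTneq hy => <-.
  exact: neg_power_half_balls_disjoint xy hx.
have [hxy|hyx] := tot (h x) (h y); [left | right]; first exact: reach.
by apply: reach; rewrite // neg_power_adj_sym.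
Qed.

Theorem theorem7 (G : sgraph) (sigma : signature G) (k : nat) (k_gt0 : 0 < k) :
  chi (neg_power sigma k) <= wcol G (2 * k) /\
  (odd k -> chi (neg_power sigma k) <= wcol G (2 * k - 1)).
Proof.
split=> [|k_odd]; apply: chi_neg_power_le => //; first exact: leq_subr.
by rewrite k_odd.
Qed.
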